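(* If a CLD-formula is satisfied in a finite pseudomodel, then it is satisfied in a model.
   Context: Let $N$ be a finite set of agents and $\Theta$ a set of atomic propositions. CLD-formulas: $\phi ::= p \mid \neg\phi \mid \phi\wedge\phi \mid [H]\phi \mid K_i\phi \mid D_G\phi$ ($H\subseteq N$, $\emptyset\neq G\subseteq N$). An effectivity function $E$ on $S$ is truly playable if for all $s$: (E1) $\emptyset\notin E(G)(s)$; (E2) $S\in E(G)(s)$; (E3) $S\setminus X\notin E(\emptyset)(s)\Rightarrow X\in E(N)(s)$; (E4) if $X\subseteq Y$ and $X\in E(G)(s)$ then $Y\in E(G)(s)$; (E5) $X\in E(G_1)(s)$, $Y\in E(G_2)(s)$, $G_1\cap G_2=\emptyset$ imply $X\cap Y\in E(G_1\cup G_2)(s)$; (E6) the set of $\subseteq$-minimal elements of $E(\emptyset)(s)$ is non-empty. A model is $\langle S,E,\sim_1,\ldots,\sim_n,V\rangle$ with $S$ non-empty, $V$ a valuation, $\sim_i$ equivalence relations and $E$ truly playable; there $M,s\models D_G\phi$ iff $\phi$ holds at every $t$ with $(s,t)\in\bigcap_{i\in G}\sim_i$. A pseudomodel is $(S,\{\sim_i\},\{R_G:\emptyset\neq G\subseteq N\},E,V)$ where $(S,E,\{\sim_i\},V)$ is a model, each $R_G$ is an equivalence relation, $R_{\{i\}}=\sim_i$, and $G\subseteq H\Rightarrow R_H\subseteq R_G$; in a pseudomodel $D_G\phi$ is instead interpreted via $R_G$. In both, $M,s\models[G]\phi$ iff $\{t:M,t\models\phi\}\in E(G)(s)$ and $K_i\phi$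 is interpreted via $\sim_i$. *)

(* Defs.v *)
From mathcomp Require Import all_boot.
From mathcomp Require Import boolp classical_sets cardinality.
From Stdlib Require Import RelationClasses.

Set Implicit Arguments.
Unset Strict Implicit.
Unset Printing Implicit Defensive.

Local Open Scope classical_set_scope.

(* [finset.set0] and [finset.setT] are sets of agents in [{set N}], whereas
   plain [set0] and [setT] are sets of states, i.e. classical sets. *)

Definition coalition (N : finType) := {G : {set N} | G != finset.set0}.

Lemma set1_neq0 (N : finType) (i : N) : finset.set1 i != finset.set0.
Proof. by apply/set0Pn; exists i; rewrite finset.in_set1. Qed.

Definition coalition1 (N : finType) (i : N) : coalition N :=
  exist _ (finset.set1 i) (set1_neq0 i).

Inductive formula (N : finType) (Theta : Type) : Type :=
| Atom (p : Theta)
| Neg (phi : formula N Theta)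
| And (phi psi : formula N Theta)
| Able (H : {set N}) (phi : formula N Theta)
| Know (i : N) (phi : formula N Theta)
| Dist (G : coalition N) (phi : formula N Theta).

Definition effectivity (N : finType) (S : Type) :=
  {set N} -> S -> set (set S).

Definition minimal_elements (S : Type) (F : set (set S)) : set (set S) :=
  [set X | F X /\ forall Y, F Y -> Y `<=` X -> Y = X].

Record truly_playable (N : finType) (S : Type) (E : effectivity N S) : Prop :=
  TrulyPlayable {
  tp_liveness : forall s G, ~ E G s set0;
  tp_safety : forall s G, E G s setT;
  tp_Nmaximality :
    forall s X, ~ E finset.set0 s (setT `\` X) -> E finset.setT s X;
  tp_monotonicity : forall s G X Y, X `<=` Y -> E G s X -> E G s Y;
  tp_superadditivity : forall s G1 G2 X Y,
    E G1 s X -> E G2 s Y -> G1 :&: G2 = finset.set0 ->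
    E (G1 :|: G2) s (X `&` Y);
  tp_crown : forall s, minimal_elements (E finset.set0 s) !=set0 }.

Record model (N : finType) (Theta : Type) := Model {
  state : Type;
  eff : effectivity N state;
  sim : N -> state -> state -> Prop;
  valuation : Theta -> set state;
  state_nonempty : [set: state] !=set0;
  sim_equiv : forall i, Equivalence (sim i);
  eff_truly_playable : truly_playable eff }.

Arguments valuation {N Theta} m p _.

Record pseudomodel (N : finType) (Theta : Type) := Pseudomodel {
  pm_model :> model N Theta;
  pm_rel : coalition N -> state pm_model -> state pm_model -> Prop;
  pm_rel_equiv : forall G, Equivalence (pm_rel G);
  pm_rel1 : forall i s t, pm_rel (coalition1 i) s t <-> sim i s t;
  pm_rel_anti : forall G H : coalition N, sval G \subset sval H ->
    forall s t, pm_rel H s t -> pm_rel G s t }.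

(* The clauses shared by both semantics; [R] interprets the modalities D_G. *)
Fixpoint truth_with (N : finType) (Theta : Type) (M : model N Theta)
    (R : coalition N -> state M -> state M -> Prop) (phi : formula N Theta) :
    set (state M) :=
  match phi with
  | Atom p => valuation M p
  | Neg psi => ~` truth_with R psi
  | And psi1 psi2 => truth_with R psi1 `&` truth_with R psi2
  | Able H psi => [set s | eff H s (truth_with R psi)]
  | Know i psi => [set s | forall t, sim i s t -> truth_with R psi t]
  | Dist G psi => [set s | forall t, R G s t -> truth_with R psi t]
  end.

Definition sat (N : finType) (Theta : Type) (M : model N Theta) (s : state M)
    (phi : formula N Theta) : Prop :=
  truth_with
    (fun G s t => forall i, i \in sval G -> sim i s t) phi s.

Definition psat (N : finType) (Theta : Type) (M : pseudomodel N Theta)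
    (s : state M) (phi : formula N Theta) : Prop :=
  truth_with (@pm_rel N Theta M) phi s.

Definition finite_pseudomodel (N : finType) (Theta : Type)
    (M : pseudomodel N Theta) : Prop :=
  finite_set [set: state M].

(* Main.v *)
Require Import Defs.
From mathcomp Require Import all_boot.
From mathcomp Require Import boolp classical_sets.
From Stdlib Require Import RelationClasses.

(** Each state [s] of the pseudomodel is copied along [h : coalition N -> A],
  where [A] is the group of maps from tests [chi : S -> bool] to Z/2; [s] lies
  in [A] as [chi |-> chi s].  Two copies are [i]-related when they have the same
  total [s + \sum_G h G] and their [h G] agree for [G] without [i], and on
  [R_G]-invariant tests for the other [G].  If two copies are [i]-related
  for all [i] in [K], their [h G] agree on every [R_K]-invariant test: for
  [G] containing [K] because [R_G] is included in [R_K], for the other [G] by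
  some [i] in [K] outside [G].  Equality of the totals then forces [s] and
  [t] to pass the same [R_K]-invariant tests, so [R_K s t].  Conversely, an
  [R_K]-step from [s] to [t] lifts by adding [s + t] to the entry [h K].
  Effectivity is pulled back along the projection, by images for the grand
  coalition and by universal images for the other coalitions; this needs
  [setT != set0], and without agents the pseudomodel is already a model. *)

Set Implicit Arguments.
Unset Strict Implicit.
Unset Printing Implicit Defensive.

Local Open Scope classical_set_scope.

Section Effectivity.
Variables (N : finType) (S T : Type) (f : T -> S) (E : effectivity N S).

Definition universal_image (Y : set T) : set S :=
  [set s | forall y, f y = s -> Y y].

(* Universal images alone would violate N-maximality, since [Y] need not be a
   union of fibres of [f]. *)
Definition pullback_eff : effectivity N T := fun G x Y =>
  E G (f x) (if G == finset.setT then f @` Y else universal_image Y).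

Hypothesis f_surj : forall s, exists x, f x = s.

Lemma universal_image_preimage X : universal_image (f @^-1` X) = X.
Proof.
apply/seteqP; split=> [s XS|s Xs y /= -> //].
by have [x fx] := f_surj s; rewrite -fx; exact: XS.
Qed.

Lemma image_preimage_surj X : f @` (f @^-1` X) = X.
Proof.
apply/seteqP; split=> [_ [x Xx <-] //|s Xs].
by have [x fx] := f_surj s; exists x; rewrite //= fx.
Qed.

Lemma pullback_effE G x X : pullback_eff G x (f @^-1` X) = E G (f x) X.
Proof.
by rewrite /pullback_eff image_preimage_surj universal_image_preimage if_same.
Qed.

Lemma universal_imageI_image Y Z :
  f @` Y `&` universal_image Z `<=` f @` (Y `&` Z).
Proof. by move=> _ [[y Yy <-] Zy]; exists y => //; split=> //; exact: Zy. Qed.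

Lemma universal_image_sub_image Y : universal_image Y `<=` f @` Y.
Proof. by move=> s Ys; have [x fx] := f_surj s; exists x => //; exact: Ys. Qed.

Hypothesis N_neq0 : finset.setT != finset.set0 :> {set N}.
Hypothesis E_tp : truly_playable E.

Let set0_neqT : (finset.set0 == finset.setT :> {set N}) = false.
Proof. by rewrite eq_sym; exact/negbTE. Qed.

(** Only the empty coalition is disjoint from the grand one, so an image is only ever intersected
    with a universal image. If neither coalition is grand, two universal images meet, and
    surjectivity puts the result inside the image needed when the union is grand. *)
Lemma pullback_eff_superadditivity x G1 G2 Y Z :
  pullback_eff G1 x Y -> pullback_eff G2 x Z -> G1 :&: G2 = finset.set0 ->
  pullback_eff (G1 :|: G2) x (Y `&` Z).
Proof.
have grand Y' Z' : pullback_eff finset.setT x Y' ->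
    pullback_eff finset.set0 x Z' -> pullback_eff finset.setT x (Y' `&` Z').
  rewrite /pullback_eff eqxx set0_neqT => EY EZ.
  apply: (tp_monotonicity E_tp) (@universal_imageI_image Y' Z') _.
  rewrite -[finset.setT](finset.setU0 finset.setT).
  by apply: (tp_superadditivity E_tp); rewrite ?finset.setI0.
move=> EY EZ G12.
have [G1T|G1T] := eqVneq G1 finset.setT.
  move: G12 EY EZ; rewrite G1T finset.setTI => ->.
  by rewrite finset.setU0; exact: grand.
have [G2T|G2T] := eqVneq G2 finset.setT.
  move: G12 EY EZ; rewrite G2T finset.setIT => -> EY EZ.
  by rewrite finset.set0U setIC; exact: grand.
move: EY EZ; rewrite /pullback_eff (negbTE G1T) (negbTE G2T) => EY EZ.
apply: (tp_monotonicity E_tp) (tp_superadditivity E_tp EY EZ G12) => s [Ys Zs].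
case: ifP => _; last by move=> y fy; split; [exact: Ys|exact: Zs].
by apply: universal_imageI_image; split=> //; exact: universal_image_sub_image.
Qed.

Lemma pullback_eff_truly_playable : truly_playable pullback_eff.
Proof.
split.
- move=> x G; rewrite -(preimage_set0 f) pullback_effE.
  exact: (tp_liveness E_tp).
- move=> x G; rewrite -(preimage_setT f) pullback_effE.
  exact: (tp_safety E_tp).
- move=> x Y; rewrite /pullback_eff eqxx set0_neqT => nE.
  apply: (tp_Nmaximality E_tp); apply: contra_not nE.
  apply: (tp_monotonicity E_tp) => s [_ nYs] y fy.
  by split=> // Yy; apply: nYs; exists y.
- move=> x G Y Z YZ; apply: (tp_monotonicity E_tp).
  case: ifP => _; first exact: image_subset.
  by move=> s Ys y fy; exact/YZ/Ys.
- exact: pullback_eff_superadditivity.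
- move=> x; have [X [EX Xmin]] := tp_crown E_tp (f x).
  (* For [Y] inside the preimage, [universal_image Y] lies in [X], so equals it by minimality; hence
     [Y] contains every fibre over [X]. *)
  exists (f @^-1` X); split=> [|Y EY YX]; first by rewrite pullback_effE.
  move: EY; rewrite /pullback_eff set0_neqT => EY.
  have YX' : universal_image Y `<=` X.
    by rewrite -[X in _ `<=` X]universal_image_preimage => s Ys y /Ys /YX.
  apply/seteqP; split=> // y; rewrite -(Xmin _ EY YX') /=.
  exact.
Qed.

End Effectivity.

Section Copies.
Variables (N : finType) (Theta : Type) (M : pseudomodel N Theta).

Definition test := state M -> bool.

Definition copy : Type := state M * (coalition N -> test -> bool).

Definition invariant_test (G : coalition N) (chi : test) : Prop :=
  forall s t, pm_rel G s t -> chi s = chi t.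

Definition total (x : copy) (chi : test) : bool :=
  chi x.1 (+) \big[addb/false]_(G : {G : {set N} | G != finset.set0}) x.2 G chi.

(** For [G] without [i] the premise is vacuous, so all tests are compared. *)
Definition copy_sim (i : N) (x y : copy) : Prop :=
  total x =1 total y /\
  forall (G : coalition N) chi, (i \in sval G -> invariant_test G chi) ->
    x.2 G chi = y.2 G chi.

Lemma copy_sim_equiv i : Equivalence (copy_sim i).
Proof.
split=> [x //|x y [xy xyG]|x y z [xy xyG] [yz yzG]].
- by split=> // G chi Gchi; rewrite xyG.
- by split=> [chi|G chi Gchi]; [rewrite xy | rewrite xyG ?yzG].
Qed.

Lemma copy_sim_rel (K : coalition N) x y :
  (forall i, i \in sval K -> copy_sim i x y) -> pm_rel K x.1 y.1.
Proof.
move=> xyK; have [K_refl K_sym K_trans] := pm_rel_equiv M K.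
(* A single test suffices: the indicator of the class of [x.1]. *)
pose chi : test := fun s => `[< pm_rel K x.1 s >].
have chiK : invariant_test K chi.
  move=> s t st; apply: asbool_equiv_eq; split=> Ks; first exact: K_trans st.
  by apply: K_trans Ks _; exact: K_sym.
have eq_entries (G : coalition N) : x.2 G chi = y.2 G chi.
  have [KG|/subsetPn[i iK iNG]] := boolP (sval K \subset sval G).
    have /set0Pn[i iK] := svalP K.
    apply: (xyK i iK).2 => _ s t /(pm_rel_anti KG); exact: chiK.
  by apply: (xyK i iK).2 => iG; rewrite iG in iNG.
have /set0Pn[i iK] := svalP K.
have := (xyK i iK).1 chi; rewrite /total (eq_bigr _ (fun G _ => eq_entries G)).
move=> /addIb chi_xy.
by apply/asboolP; rewrite -/(chi y.1) -chi_xy; exact/asboolP.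
Qed.

Lemma rel_copy_sim (K : coalition N) x t :
  pm_rel K x.1 t ->
  exists2 y : copy, y.1 = t & forall i, i \in sval K -> copy_sim i x y.
Proof.
(* Entry [K] flips exactly on the tests separating [x.1] from [t]. None of them is invariant under
   [pm_rel K], and the flip keeps the total. *)
move=> Kxt; pose h (G : coalition N) (chi : test) : bool :=
  x.2 G chi (+) ((G == K :> {G : {set N} | G != finset.set0})
                 && (chi x.1 (+) chi t)).
exists (t, h) => // i iK; split=> [chi|G chi Gchi] /=; last first.
  rewrite /h; case: eqP => [GK|_]; last by rewrite addbF.
  by move: Gchi; rewrite GK => /(_ iK) /(_ _ _ Kxt) ->; rewrite addbb addbF.
rewrite /total /= /h big_split /= -big_mkcond big_pred1_eq.
by rewrite [in RHS]addbCA [chi x.1 (+) _ in RHS]addbC addKb addbC.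
Qed.

Lemma copy_surj (s : state M) : exists x : copy, x.1 = s.
Proof. by exists (s, fun _ _ => false). Qed.

Hypothesis N_neq0 : finset.setT != finset.set0 :> {set N}.

Lemma copy_nonempty : [set: copy] !=set0.
Proof.
by have [s _] := state_nonempty M; have [x _] := copy_surj s; exists x.
Qed.

Definition copy_model : model N Theta :=
  @Model N Theta copy (pullback_eff fst (@eff N Theta M)) copy_sim
    (fun p => fst @^-1` valuation M p) copy_nonempty copy_sim_equiv
    (pullback_eff_truly_playable copy_surj N_neq0 (eff_truly_playable M)).

Lemma sat_copy (x : copy) phi : sat (M := copy_model) x phi <-> psat x.1 phi.
Proof.
rewrite /sat /psat; set R := fun _ _ _ => _.
(* The induction needs equality of whole truth sets, since [Able] applies effectivity to them. *)
suff -> : truth_with (M := copy_model) R phi =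
          fst @^-1` truth_with (@pm_rel N Theta M) phi by [].
have forth G y z : R G y z -> pm_rel G y.1 z.1 by exact: copy_sim_rel.
elim: phi => [//|psi /= -> //|psi1 /= -> psi2 -> //|H psi /= ->|i psi /= ->
  |G psi /= ->].
- by apply/funext => y; exact: (pullback_effE _ copy_surj).
- apply/seteqP; split=> y /= Ky.
    move=> t /pm_rel1 /rel_copy_sim [z <-] yz.
    by apply: Ky; apply: yz; rewrite finset.in_set1.
  move=> z yz; apply: Ky; apply/pm_rel1; apply: forth => j.
  by rewrite finset.in_set1 => /eqP ->.
- apply/seteqP; split=> y /= Gy; last by move=> z /forth; exact: Gy.
  by move=> t /rel_copy_sim [z <-] /Gy.
Qed.

End Copies.

(** A coalition has a member, so without agents no [Dist] formula exists. *)
Lemma truth_with_no_agent (N : finType) (Theta : Type) (M : model N Theta)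
    (R R' : coalition N -> state M -> state M -> Prop) phi :
  finset.setT = finset.set0 :> {set N} -> truth_with R phi = truth_with R' phi.
Proof.
move=> N0; elim: phi => [//|psi /= -> //|psi1 /= -> psi2 -> //|H psi /= -> //
  |i psi /= -> //|G psi _].
have /set0Pn[i] := svalP G.
by move: (finset.in_setT i); rewrite N0 finset.in_set0.
Qed.

Theorem theorem3 (N : finType) (Theta : Type) (phi : formula N Theta) :
  (exists (M : pseudomodel N Theta) (s : state M),
      finite_pseudomodel M /\ psat s phi) ->
  exists (M : model N Theta) (s : state M), sat s phi.
Proof.
move=> [M [s [_ Ms]]].
have [N0|N_neq0] := eqVneq (finset.setT : {set N}) finset.set0.
  by exists M, s; rewrite /sat (truth_with_no_agent _ (@pm_rel N Theta M)).
have [x xs] := copy_surj s.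
by exists (copy_model M N_neq0), x; apply/sat_copy; rewrite xs.
Qed.
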